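(* Let $X_1,X_2$ be non-negative absolutely continuous random variables with probability density functions $f_1,f_2$, let $0<r<1$, $\gamma>0$, $\beta\ge1$, and let $\omega\ge0$ be a weight function. Let $M(r,\gamma)$ be the $(r,\gamma)$-mixture random variable of $f_1$ and $f_2$. Then $$I_\beta^\omega(M(r,\gamma))=\frac{I_{\beta/\gamma}^\omega(X_\Gamma)}{\left(I_{1/\gamma}(X_\Gamma)\right)^\beta},$$ where $X_\Gamma$ is a random variable with the mixture density $f_\Gamma(x)=\Gamma f_{(\gamma,1)}(x)+(1-\Gamma)f_{(\gamma,2)}(x)$, with $$\Gamma=\frac{rI_\gamma(X_1)}{rI_\gamma(X_1)+(1-r)I_\gamma(X_2)}\quad\text{and}\quad f_{(\gamma,i)}(x)=\frac{f_i^\gamma(x)}{\int_0^\infty f_i^\gamma(u)\,du},\ i=1,2.$$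
   Context: For a non-negative absolutely continuous random variable $X$ with density $f$, a measurable weight $\omega\ge0$ and an order $p>0$, write $I_p^\omega(X)=\int_0^\infty\omega(u)f^p(u)\,du$ and $I_p(X)=\int_0^\infty f^p(u)\,du$. The $(r,\gamma)$-mixture random variable $M(r,\gamma)$ of $f_1,f_2$ is the random variable with density $f_{M(r,\gamma)}(x)=\dfrac{[rf_1^\gamma(x)+(1-r)f_2^\gamma(x)]^{1/\gamma}}{\int_0^\infty[rf_1^\gamma(u)+(1-r)f_2^\gamma(u)]^{1/\gamma}\,du}$, $x>0$. All integrals are assumed to exist (be finite). *)

(* Defs.v *)
From HB Require Import structures.
From mathcomp Require Import all_boot all_order all_algebra.
From mathcomp Require Import all_classical all_reals all_analysis.
Set Implicit Arguments.
Unset Strict Implicit.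
Unset Printing Implicit Defensive.
Import Order.TTheory GRing.Theory Num.Theory.
Import numFieldNormedType.Exports.
Local Open Scope classical_set_scope.
Local Open Scope ring_scope.

Section Defs.
Context {R : realType}.
Local Notation leb := (@lebesgue_measure R).

Definition integral0oo (g : R -> R) : R := \int[leb]_(u in `[0, +oo[) g u.

(* "The integral of g over [0, +oo[ exists (is finite)"; without this condition
   the real-valued [integral0oo g] carries a default value. *)
Definition finite_integral0oo (g : R -> R) : Prop :=
  leb.-integrable `[0, +oo[ (EFin \o g).

Definition is_density d (T : measurableType d) (P : probability T R)
    (X : {RV P >-> R}) (f : R -> R) : Prop :=
  [/\ measurable_fun setT f, (forall x, 0 <= f x) &
    forall A, measurable A ->
      distribution P X A = (\int[leb]_(x in A) (f x)%:E)%E].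

(* A fixed version of the density of X, so that the integrals below are
   functions of X alone: densities of X agree Lebesgue-almost everywhere, so
   these integrals do not depend on the version chosen. *)
Definition pdf d (T : measurableType d) (P : probability T R)
    (X : {RV P >-> R}) : R -> R :=
  xget (cst 0) [set f | is_density X f].

Definition Ip_integrand d (T : measurableType d) (P : probability T R)
    (p : R) (X : {RV P >-> R}) : R -> R :=
  fun u => pdf X u `^ p.

Definition Ipw_integrand d (T : measurableType d) (P : probability T R)
    (w : R -> R) (p : R) (X : {RV P >-> R}) : R -> R :=
  fun u => w u * pdf X u `^ p.

Definition Ip d (T : measurableType d) (P : probability T R)
    (p : R) (X : {RV P >-> R}) : R := integral0oo (Ip_integrand p X).

Definition Ipw d (T : measurableType d) (P : probability T R)
    (w : R -> R) (p : R) (X : {RV P >-> R}) : R :=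
  integral0oo (Ipw_integrand w p X).

Definition power_mean (r g : R) (f1 f2 : R -> R) : R -> R :=
  fun x => (r * f1 x `^ g + (1 - r) * f2 x `^ g) `^ g^-1.

(* The defining formula only concerns x > 0; extended by 0 elsewhere. *)
Definition mixture_density (r g : R) (f1 f2 : R -> R) : R -> R :=
  (fun x => power_mean r g f1 f2 x / integral0oo (power_mean r g f1 f2))
    \_ `]0, +oo[.

Definition escort_density (g : R) (f : R -> R) : R -> R :=
  fun x => f x `^ g / integral0oo (fun u => f u `^ g).

End Defs.

(* Main.v *)
(* Put A = r f1^gamma + (1-r) f2^gamma and S = r I_gamma(X1) + (1-r) I_gamma(X2).
   The weights Gamma, 1 - Gamma cancel the normalisations of the escort
   densities, so X_Gamma has density A / S, while M has density A^(1/gamma) / N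
   with N the integral of A^(1/gamma); the powers of S cancel in the quotient.
   This requires I_gamma(Xi) > 0: otherwise fi would vanish almost everywhere on
   [0, +oo[, contradicting Xi >= 0 almost surely. *)
Require Import Defs.
From HB Require Import structures.
From mathcomp Require Import all_boot all_order all_algebra.
From mathcomp Require Import all_classical all_reals all_analysis.
From mathcomp Require Import measurable_realfun ring.
Set Implicit Arguments.
Unset Strict Implicit.
Unset Printing Implicit Defensive.
Import Order.TTheory GRing.Theory Num.Theory.
Import numFieldNormedType.Exports.
Local Open Scope classical_set_scope.
Local Open Scope ring_scope.

#[local] Instance lebesgue_ae_filter (R : realType) :
  Filter (almost_everywhere (@lebesgue_measure R)).
Proof. exact: (ae_filter_ringOfSetsType lebesgue_measure). Qed.

(** Both densities integrate to the law of [X] over every measurable set, and total mass 1 makes [f]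
    integrable; together these force equality almost everywhere. *)
Lemma density_unique (R : realType) (d : measure_display) (T : measurableType d)
  (P : probability T R) (X : {RV P >-> R}) (f g : R -> R) :
  is_density X f -> is_density X g ->
  {ae @lebesgue_measure R, forall x, f x = g x}.
Proof.
move=> [mf f0 fX] [mg g0 gX].
have fg : ae_eq (@lebesgue_measure R) setT (EFin \o f) (EFin \o g).
  apply: integral_ae_eq => //.
  - apply/integrableP; split; first exact/measurable_EFinP.
    under eq_integral => x _ do rewrite /= ger0_norm//.
    by rewrite -fX// probability_setT ltry.
  - exact/measurable_EFinP.
  - by move=> E _ mE; rewrite -fX// -gX.
by apply: filterS fg => x /(_ I) [].
Qed.

Lemma pdf_is_density (R : realType) (d : measure_display) (T : measurableType d)
  (P : probability T R) (X : {RV P >-> R}) (f : R -> R) :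
  is_density X f -> is_density X (pdf X).
Proof.
by move=> fX; apply: (@xgetPex _ (cst 0) [set g | is_density X g]); exists f.
Qed.

Lemma pdf_ae (R : realType) (d : measure_display) (T : measurableType d)
  (P : probability T R) (X : {RV P >-> R}) (f : R -> R) :
  is_density X f -> {ae @lebesgue_measure R, forall x, pdf X x = f x}.
Proof. by move=> fX; exact: density_unique (pdf_is_density fX) fX. Qed.

(** Agreement is asked for only at positive points because [mixture_density] is set to 0 at the
    origin; that single point is a null set. *)
Lemma ae_eq_integral0oo (R : realType) (f g : R -> R) :
  measurable_fun (`[0, +oo[%classic : set R) f ->
  measurable_fun (`[0, +oo[%classic : set R) g ->
  {ae @lebesgue_measure R, forall x, 0 < x -> f x = g x} ->
  integral0oo f = integral0oo g.
Proof.
move=> mf mg fg; rewrite /integral0oo /Rintegral; congr fine.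
apply: ae_eq_integral => //; try exact/measurable_EFinP.
have n0 : {ae @lebesgue_measure R, forall x, x != 0}.
  exists [set 0]; split => //; first exact: lebesgue_measure_set1.
  by move=> x /= /negP; rewrite negbK => /eqP.
apply: (filterS2 _ _ fg n0) => x {}fg x0 /=; rewrite in_itv/= andbT => x_ge0.
by rewrite fg// lt_neqAle eq_sym x0.
Qed.

(* If the integral is infinite, both sides are the default value 0. *)
Lemma integral0ooZl (R : realType) (k : R) (f : R -> R) :
  0 <= k -> measurable_fun (`[0, +oo[%classic : set R) f ->
  (forall x, 0 <= x -> 0 <= f x) ->
  integral0oo (fun x => k * f x) = k * integral0oo f.
Proof.
move=> k0 mf f0.
have fineZ (I : \bar R) : fine (k%:E * I) = k * fine I.
  have [->|kn0] := eqVneq k 0; first by rewrite mul0e mul0r.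
  have k_gt0 : 0 < k by rewrite lt_neqAle eq_sym kn0.
  by case: I => [s| |] //; rewrite ?gt0_muley ?gt0_muleNy ?lte_fin// mulr0.
rewrite /integral0oo /Rintegral.
under eq_integral => x _ do rewrite EFinM.
rewrite ge0_integralZl//; first exact/measurable_EFinP.
by move=> x /=; rewrite in_itv/= andbT lee_fin => /f0.
Qed.

Lemma Ip_gt0 (R : realType) (d : measure_display) (T : measurableType d)
  (P : probability T R) (X : {RV P >-> R}) (f : R -> R) (p : R) :
  is_density X f -> {ae P, forall t, 0 <= X t} ->
  finite_integral0oo (Ip_integrand p X) -> 0 < Ip p X.
Proof.
move=> /pdf_is_density[mf f0 fX] X0 fin.
have ge0 : 0 <= Ip p X by apply: Rintegral_ge0 => x _; exact: powR_ge0.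
rewrite lt_neqAle ge0 andbT eq_sym; apply/negP => /eqP Ip0.
(* Finiteness enters here: a zero real value could otherwise be the default value of an infinite
   integral. *)
have int0 : (\int[@lebesgue_measure R]_(x in `[0%R, +oo[) (pdf X x `^ p)%:E = 0)%E.
  rewrite -[LHS]fineK; first by rewrite [fine _]Ip0.
  exact: integrable_fin_num.
have mp : measurable_fun (`[0, +oo[%classic : set R) (fun x => pdf X x `^ p).
  by apply: measurableT_comp (measurable_powR p) _; exact: measurable_funS mf.
have /(ae_eq_integral_abs _ _) ae0 :
    (\int[@lebesgue_measure R]_(x in `[0%R, +oo[) `|(pdf X x `^ p)%:E| = 0)%E.
  rewrite -[RHS]int0; apply: eq_integral => x _.
  by rewrite /= ger0_norm// powR_ge0.
have P0 : (distribution P X `[0%R, +oo[ = 0)%E.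
  rewrite fX// -[RHS](@integral0 _ _ _ (@lebesgue_measure R) `[0, +oo[).
  apply: ae_eq_integral => //.
    by apply/measurable_EFinP; exact: measurable_funS mf.
  apply: filterS (ae0 _ _) => //; last exact/measurable_EFinP.
  (* A vanishing power has base 0 whatever the exponent, since 0 to the power 0 is 1. *)
  move=> x /[apply] -[/eqP].
  by rewrite powR_eq0 => /andP[/eqP -> _].
have := probability_setT P.
suff -> : P setT = 0%E by move/eqP; rewrite eqe eq_sym oner_eq0.
have Xneg : {ae P, forall t, ~ 0 <= X t}.
  exists (X @^-1` `[0, +oo[); split => //.
    by rewrite -[X in measurable X]setTI; exact: measurable_funP.
  by move=> t /= /notP; rewrite in_itv/= andbT.
(* [X0] and [Xneg] contradict each other at every point, so the whole space lies in a null set. *)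
have [N [mN N0 TN]] : {ae P, forall t : T, False} by apply: filterS2 X0 Xneg.
by apply/eqP; rewrite -measure_le0 -N0 le_measure// ?inE// => t _; exact: TN.
Qed.

Lemma measurable_fun_powR (R : realType) (D : set R) (g : R -> R) (p : R) :
  measurable_fun D g -> measurable_fun D (fun x => g x `^ p).
Proof. by move=> mg; exact: measurableT_comp (measurable_powR p) mg. Qed.

(** Passes from the chosen version [pdf X] to an explicit density, with which the main proof can
    compute. *)
Lemma Ip_density (R : realType) (d : measure_display) (T : measurableType d)
  (P : probability T R) (X : {RV P >-> R}) (f : R -> R) (p : R) :
  is_density X f -> Ip p X = integral0oo (fun u => f u `^ p).
Proof.
move=> fX; have [mf _ _] := fX; have [mpf _ _] := pdf_is_density fX.
apply: ae_eq_integral0oo.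
- by apply: measurable_fun_powR; exact: measurable_funTS.
- by apply: measurable_fun_powR; exact: measurable_funTS.
- by apply: filterS (pdf_ae fX) => x fx _; rewrite /Ip_integrand fx.
Qed.

Lemma Ipw_density (R : realType) (d : measure_display) (T : measurableType d)
  (P : probability T R) (X : {RV P >-> R}) (w f : R -> R) (p : R) :
  measurable_fun (`[0, +oo[%classic : set R) w -> is_density X f ->
  Ipw w p X = integral0oo (fun u => w u * f u `^ p).
Proof.
move=> mw fX; have [mf _ _] := fX; have [mpf _ _] := pdf_is_density fX.
apply: ae_eq_integral0oo.
- apply: measurable_funM; first exact: mw.
  by apply: measurable_fun_powR; exact: measurable_funTS.
- apply: measurable_funM; first exact: mw.
  by apply: measurable_fun_powR; exact: measurable_funTS.
- by apply: filterS (pdf_ae fX) => x fx _; rewrite /Ipw_integrand fx.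
Qed.

Theorem theorem4p3 (R : realType)
  (d1 d2 dM dG : measure_display)
  (T1 : measurableType d1) (T2 : measurableType d2)
  (TM : measurableType dM) (TG : measurableType dG)
  (P1 : probability T1 R) (P2 : probability T2 R)
  (PM : probability TM R) (PG : probability TG R)
  (X1 : {RV P1 >-> R}) (X2 : {RV P2 >-> R})
  (M : {RV PM >-> R}) (XG : {RV PG >-> R})
  (f1 f2 w : R -> R) (r gamma beta : R)
  (X1_ge0 : {ae P1, forall t, 0 <= X1 t})
  (X2_ge0 : {ae P2, forall t, 0 <= X2 t})
  (f1_density : is_density X1 f1)
  (f2_density : is_density X2 f2)
  (r_gt0 : 0 < r) (r_lt1 : r < 1) (gamma_gt0 : 0 < gamma) (beta_ge1 : 1 <= beta)
  (w_meas : measurable_fun (`[0, +oo[%classic : set R) w)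
  (w_ge0 : forall x, 0 <= x -> 0 <= w x) :
  (* M is the (r, gamma)-mixture random variable of f1 and f2 *)
  finite_integral0oo (power_mean r gamma f1 f2) ->
  is_density M (mixture_density r gamma f1 f2) ->
  (* XG has the mixture density with weight Gamma *)
  finite_integral0oo (Ip_integrand gamma X1) ->
  finite_integral0oo (Ip_integrand gamma X2) ->
  let Gamma :=
    r * Ip gamma X1 / (r * Ip gamma X1 + (1 - r) * Ip gamma X2) in
  is_density XG (fun x => Gamma * escort_density gamma f1 x
                          + (1 - Gamma) * escort_density gamma f2 x) ->
  (* the integrals in the conclusion are finite *)
  finite_integral0oo (Ipw_integrand w beta M) ->
  finite_integral0oo (Ipw_integrand w (beta / gamma) XG) ->
  finite_integral0oo (Ip_integrand gamma^-1 XG) ->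
  Ipw w beta M = Ipw w (beta / gamma) XG / Ip gamma^-1 XG `^ beta.
Proof.
move=> A_fin M_dens fin1 fin2 Gamma XG_dens _ _ _.
have [[mf1 _ _] [mf2 _ _]] := (f1_density, f2_density).
have c1_gt0 := Ip_gt0 f1_density X1_ge0 fin1.
have c2_gt0 := Ip_gt0 f2_density X2_ge0 fin2.
pose A x := r * f1 x `^ gamma + (1 - r) * f2 x `^ gamma.
pose N := integral0oo (power_mean r gamma f1 f2).
have r'_gt0 : 0 < 1 - r by rewrite subr_gt0.
rewrite /Gamma {Gamma} /escort_density in XG_dens.
(* The escort normalisations become the same terms as the integrals in [Gamma], so that they can
   cancel. *)
rewrite -(Ip_density gamma f1_density) -(Ip_density gamma f2_density) in XG_dens.
(* Abstract the two integrals: conversion would otherwise try to unfold them. *)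
move: (Ip gamma X1) (Ip gamma X2) c1_gt0 c2_gt0 XG_dens => c1 c2 c1_gt0 c2_gt0.
pose S := r * c1 + (1 - r) * c2.
have S_gt0 : 0 < S by rewrite addr_gt0// mulr_gt0.
(* Here Gamma / c1 = r / S and (1 - Gamma) / c2 = (1 - r) / S. *)
rewrite (_ : (fun x => _) = (fun x => S^-1 * A x)) => [XG_dens|]; last first.
  have := S_gt0; rewrite /S => /gt_eqF/negbT S_neq0.
  apply/funext => x; rewrite /A.
  by field; rewrite S_neq0 !gt_eqF.
have A_ge0 x : 0 <= A x.
  by rewrite addr_ge0// mulr_ge0 ?powR_ge0// ltW.
have mA : measurable_fun setT A.
  by apply: measurable_funD; apply: measurable_funM => //; exact: measurable_fun_powR.
have mAp D p : measurable_fun D (fun x => A x `^ p).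
  by apply: measurable_fun_powR; exact: measurable_funTS.
(* The power laws below use only this sign: at N = 0, both the inverse of N and its power of
   exponent -1 are 0. *)
have N_ge0 : 0 <= N by apply: Rintegral_ge0 => x _; exact: powR_ge0.
(* The factor 1/S comes out as a power, and what remains is the integral of A^(1/gamma), which is
   [power_mean] by definition. *)
have IXG : Ip gamma^-1 XG = S `^ (- gamma^-1) * N.
  rewrite (Ip_density _ XG_dens) -integral0ooZl ?powR_ge0//; last 2 first.
  - exact: mAp.
  - by move=> x _; exact: powR_ge0.
  congr integral0oo; apply/funext => x.
  rewrite powRM ?invr_ge0 ?(ltW S_gt0)// -powR_inv1 ?(ltW S_gt0)//.
  by rewrite -powRrM mulN1r.
have IwXG : Ipw w (beta / gamma) XG =
    S `^ (- (beta / gamma)) * integral0oo (fun x => w x * A x `^ (beta / gamma)).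
  rewrite (Ipw_density _ w_meas XG_dens) -integral0ooZl ?powR_ge0//; last 2 first.
  - by apply: measurable_funM.
  - by move=> x /w_ge0 wx; rewrite mulr_ge0 ?powR_ge0.
  congr integral0oo; apply/funext => x.
  rewrite powRM ?invr_ge0 ?(ltW S_gt0)// -powR_inv1 ?(ltW S_gt0)//.
  by rewrite -powRrM mulN1r mulrCA.
have IwM : Ipw w beta M =
    N `^ (- beta) * integral0oo (fun x => w x * A x `^ (beta / gamma)).
  rewrite (Ipw_density _ w_meas M_dens) -integral0ooZl ?powR_ge0//; last 2 first.
  - by apply: measurable_funM.
  - by move=> x /w_ge0 wx; rewrite mulr_ge0 ?powR_ge0.
  have [mM _ _] := M_dens.
  apply: ae_eq_integral0oo.
  - apply: measurable_funM => //.
    by apply: measurable_fun_powR; exact: measurable_funTS.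
  - by apply: measurable_funM => //; apply: measurable_funM.
  apply: nearW => x x_gt0; rewrite /mixture_density patchE mem_set; last first.
    by rewrite /= in_itv/= andbT.
  rewrite -/N powRM ?powR_ge0 ?invr_ge0// -(powR_inv1 N_ge0) -!powRrM mulN1r.
  by rewrite -/(A x) [_^-1 * _]mulrC [RHS]mulrC mulrA.
(* Raising [IXG] to the power beta gives S^(-beta/gamma) N^beta, whose first factor is the one in
   [IwXG]; the quotient leaves N^(-beta), as in [IwM]. *)
rewrite IwM IwXG IXG powRM ?powR_ge0// -powRrM mulNr [gamma^-1 * _]mulrC.
rewrite -mulf_div divff; last by rewrite powR_eq0 (gt_eqF S_gt0).
by rewrite mul1r mulrC powRN.
Qed.
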